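(* Let $M\in\mathbb{C}$ satisfy $\Re M>0$, and let $$b_0=2M-1,\qquad b_n=2M\,\frac{2n+1}{n(n+1)},\qquad n\in\{1,2,3,\ldots\}.$$ Then the continued fraction $b_0+\mathop{\mathbf{K}}_{n=1}^{\infty}\frac{1}{b_n}$ converges and $$2M^2\,\Phi(1,2,M+1)=2M^2\,\zeta(2,M+1)=b_0+\mathop{\mathbf{K}}_{n=1}^{\infty}\frac{1}{b_n}.$$
   Context: The Lerch transcendent is $\Phi(z,s,a)=\sum_{n=0}^{\infty}\frac{z^n}{(n+a)^s}$ for $a\notin\{0,-1,-2,\ldots\}$, and the Hurwitz zeta function is $\zeta(s,a)=\Phi(1,s,a)$; in particular $\zeta(2,M+1)=\sum_{n=0}^\infty \frac{1}{(n+M+1)^2}$. For complex sequences $(a_n)_{n\ge1}$, $(b_n)_{n\ge 0}$, the continued fraction $b_0+\mathop{\mathbf{K}}_{n=1}^{\infty}\frac{a_n}{b_n}=b_0+\cfrac{a_1}{b_1+\cfrac{a_2}{b_2+\cdots}}$ has convergents $f_n=A_n/B_n$, where $A_{-1}=1$, $A_0=b_0$, $B_{-1}=0$, $B_0=1$, and $A_n=b_nA_{n-1}+a_nA_{n-2}$, $B_n=b_nB_{n-1}+a_nB_{n-2}$ for $n\ge1$. The continued fraction converges, with value $f$, if $\lim_{n\to\infty}f_n=f$ exists. Here all partial numerators are $a_n=1$. *)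

(* Defs.v *)
From Stdlib Require Import Reals Lra.
From Coquelicot Require Import Coquelicot.
Open Scope R_scope.

Definition cexp (z : C) : C :=
  (exp (Re z) * cos (Im z), exp (Re z) * sin (Im z)).

(* Principal argument, in (-PI, PI]; meaningful for w <> 0. *)
Definition carg (w : C) : R :=
  if Rle_dec 0 (Im w) then acos (Re w / Cmod w) else - acos (Re w / Cmod w).

Definition clog (w : C) : C := (ln (Cmod w), carg w).

(* w^s on the principal branch, for w <> 0. *)
Definition cpower (w s : C) : C := cexp (s * clog w)%C.

(* Meaningful when the series converges; see [CSeries_unique]. *)
Definition CSeries (u : nat -> C) : C :=
  (Series (fun n => Re (u n)), Series (fun n => Im (u n))).

Definition lerch_term (z s a : C) (n : nat) : C :=
  (z ^ n / cpower (INR n + a) s)%C.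

Definition ex_lerch (z s a : C) : Prop :=
  ex_series (V := C_NormedModule) (lerch_term z s a).

Definition Lerch (z s a : C) : C := CSeries (lerch_term z s a).

Definition Hurwitz (s a : C) : C := Lerch 1 s a.

(* [three_term a b x0 xm1 n] is the pair (X_n, X_{n-1}), where X_{-1} = xm1,
   X_0 = x0 and X_n = b_n X_{n-1} + a_n X_{n-2} for n >= 1; [a 0] and [b 0]
   are not used. *)
Fixpoint three_term (a b : nat -> C) (x0 xm1 : C) (n : nat) : C * C :=
  match n with
  | O => (x0, xm1)
  | S m => let (x, y) := three_term a b x0 xm1 m in
           ((b n * x + a n * y)%C, x)
  end.

Definition cf_num (a b : nat -> C) (n : nat) : C :=
  fst (three_term a b (b O) 1 n).

Definition cf_den (a b : nat -> C) (n : nat) : C :=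
  fst (three_term a b 1 0 n).

(* b_0 + K_{n >= 1} (a_n / b_n) converges to the finite value f. A convergent
   with zero denominator is undefined (or infinite), so for a finite limit the
   denominators have to be nonzero from some index on; this excludes the
   spurious value of x / 0. *)
Definition is_contfrac (a b : nat -> C) (f : C) : Prop :=
  eventually (fun n => cf_den a b n <> 0) /\
  filterlim (fun n => (cf_num a b n / cf_den a b n)%C) eventually
    (locally (T := C_UniformSpace) f).

Lemma CSeries_unique (u : nat -> C) (l : C) :
  is_series (V := C_NormedModule) u l -> CSeries u = l.
Proof.
intros H.
assert (Hs : forall n, Re (sum_n (G := C_NormedModule) u n)
                       = sum_n (fun k => Re (u k)) n /\
                       Im (sum_n (G := C_NormedModule) u n)
                       = sum_n (fun k => Im (u k)) n).
{ induction n as [|n [IH1 IH2]].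
  - now rewrite !sum_O.
  - rewrite !sum_Sn, <- IH1, <- IH2. now split. }
assert (HR : is_series (fun n => Re (u n)) (Re l)).
{ apply filterlim_locally. intros eps.
  assert (Hl : locally (T := C_UniformSpace) l
                 (fun y => ball (Re l) eps (Re y))).
  { exists eps. intros y [Hy _]. exact Hy. }
  specialize (H _ Hl).
  unfold filtermap in H. revert H. apply filter_imp.
  intros n Hn. now rewrite (proj1 (Hs n)) in Hn. }
assert (HI : is_series (fun n => Im (u n)) (Im l)).
{ apply filterlim_locally. intros eps.
  assert (Hl : locally (T := C_UniformSpace) l
                 (fun y => ball (Im l) eps (Im y))).
  { exists eps. intros y [_ Hy]. exact Hy. }
  specialize (H _ Hl).
  unfold filtermap in H. revert H. apply filter_imp.
  intros n Hn. now rewrite (proj2 (Hs n)) in Hn. }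
unfold CSeries. rewrite (is_series_unique _ _ HR), (is_series_unique _ _ HI).
now destruct l.
Qed.

Lemma cexp_plus (x y : C) : cexp (x + y)%C = (cexp x * cexp y)%C.
Proof.
destruct x as [a b], y as [c d]. unfold cexp, Cplus, Cmult, Re, Im; simpl.
rewrite exp_plus, cos_plus, sin_plus. f_equal; ring.
Qed.

Lemma cexp_clog (w : C) : w <> 0 -> cexp (clog w) = w.
Proof.
intros Hw. pose proof (proj1 (Cmod_gt_0 w) Hw) as Hm.
unfold cexp, clog; simpl. rewrite exp_ln by exact Hm.
assert (HS : Cmod w * Cmod w = Re w * Re w + Im w * Im w).
{ unfold Cmod, Re, Im. rewrite sqrt_sqrt; [ring | nra]. }
set (t := Re w / Cmod w).
assert (Hc : Cmod w * t = Re w) by (unfold t; field; lra).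
assert (Hx : - Cmod w <= Re w <= Cmod w) by (split; nra).
assert (Ht : -1 <= t <= 1).
{ split; apply Rmult_le_reg_l with (1 := Hm); rewrite Hc; lra. }
assert (Hs : Cmod w * sin (acos t) = Rabs (Im w)).
{ rewrite sin_acos by exact Ht.
  rewrite <- (sqrt_Rsqr (Cmod w)) at 1 by lra.
  rewrite <- sqrt_mult_alt by apply Rle_0_sqr.
  rewrite <- sqrt_Rsqr_abs. f_equal. unfold Rsqr. nra. }
unfold carg. fold t. destruct w as [x y]; simpl in *.
destruct (Rle_dec 0 y) as [Hy|Hy].
- rewrite cos_acos, Hc, Hs, Rabs_pos_eq by assumption. reflexivity.
- rewrite cos_neg, sin_neg, cos_acos, Hc by assumption.
  rewrite Ropp_mult_distr_r_reverse, Hs, Rabs_left by lra. f_equal. ring.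
Qed.

Lemma cpower_nat (w : C) (n : nat) : w <> 0 -> cpower w (INR n) = (w ^ n)%C.
Proof.
intros Hw. unfold cpower. induction n as [|n IH].
- simpl. unfold cexp, Cmult; simpl.
  rewrite !Rmult_0_l, Rminus_0_r, Rplus_0_l, exp_0, cos_0, sin_0.
  rewrite Rmult_1_l, Rmult_0_r. reflexivity.
- rewrite S_INR, RtoC_plus, Cmult_plus_distr_r, cexp_plus, IH, Cmult_1_l.
  rewrite cexp_clog by exact Hw. simpl. ring.
Qed.

(* Main.v *)
Require Import Defs.
From Stdlib Require Import Reals Lra Lia ZArith.
From Coquelicot Require Import Coquelicot.
Open Scope R_scope.

(** The remainders A_n - f B_n of the continued fraction are known explicitly.
    With J_m the double integral over the unit square
      J_m = int int (x y)^(M-1) ((1-x)(1-y)/(1-xy))^m dx dy,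
    one has J_0 = 1/M^2, the recurrence
      J_(m-1) - J_(m+1) = 2 M (2m+1) / (m (m+1)) J_m      (m >= 1),
    and, since (1/t - 1/(t+1))^2 and 2/(t+1)^2 differ by a telescoping term,
      M^2 J_1 = 2 M^2 zeta(2,M+1) - (2M - 1).
    As the coefficient of J_m is b_m, the sequence (-1)^(n+1) M^2 J_(n+1)
    satisfies the recurrence of A_n and B_n and starts like A_n - f B_n for
    f = 2 M^2 zeta(2,M+1); so it is that remainder.

    Expanding (1-xy)^(-m) turns J_m into the series of the terms
      binomial(m-1+k, k) (m! / (t (t+1) ... (t+m)))^2,   t = M + k.
    These terms are [kern M (m-1) k], and the argument below works with them.
    The recurrence holds for them up to a difference G(k) - G(k+1) with G
    rational over the term ([kern_cert]), in the manner of Zeilberger, and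
    summation gives [kern_sum_rec].

    The remainders are bounded ([kern_sum_bounded]): the terms for M are
    dominated by those for the real number Re M, and for real M > 0 the
    recurrence with J_m >= 0 yields J_(m+1) <= J_(m-1).

    A bounded remainder forces convergence
    ([contfrac_of_bounded_remainder]). Put E_n = Re (B_n conj B_(n-1)). Then
    E_n = E_(n-1) + Re b_n |B_(n-1)|^2, so E_n is positive and increasing from
    n = 1 on, and it tends to infinity because Re b_n dominates a decreasing
    positive sequence with divergent sum. Hence |B_n B_(n-1)| tends to infinity. If |B_n| is large,
    then A_n/B_n - f = (A_n - f B_n)/B_n is small; otherwise |B_(n-1)| is
    large, and A_n/B_n differs from A_(n-1)/B_(n-1) by 1/|B_n B_(n-1)|. *)

(** * Limits of complex sequences *)

Lemma Cmod_le_Rabs (z : C) : Cmod z <= Rabs (Re z) + Rabs (Im z).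
Proof.
replace z with (RtoC (Re z) + Ci * RtoC (Im z))%C at 1
  by (destruct z; unfold RtoC, Ci, Cplus, Cmult; simpl; f_equal; ring).
eapply Rle_trans; [apply Cmod_triangle|].
rewrite Cmod_mult, Cmod_Ci, !Cmod_R. lra.
Qed.

Lemma C_lim_of_bound (u : nat -> C) (l : C) (e : nat -> R) :
  is_lim_seq e 0 -> eventually (fun n => Cmod (u n - l)%C <= e n) ->
  filterlim u eventually (locally (T := C_UniformSpace) l).
Proof.
intros He [N HN].
assert (H0 : filterlim (fun n => minus (G := C_NormedModule) (u n) l) eventually
               (locally (T := C_UniformSpace) (RtoC 0))).
{ apply (filterlim_norm_zero (V := C_NormedModule)).
  apply (is_lim_seq_le_le_loc (fun _ => 0) _ e 0).
  - exists N. intros n Hn. change (0 <= Cmod (u n - l)%C <= e n).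
    split; [apply Cmod_ge_0 | exact (HN n Hn)].
  - apply is_lim_seq_const.
  - exact He. }
assert (H1 : filterlim
  (fun n => plus (G := C_NormedModule) (minus (G := C_NormedModule) (u n) l) l)
  eventually (locally (plus (G := C_NormedModule) (RtoC 0) l))).
{ eapply filterlim_comp_2; [exact H0 | apply filterlim_const |].
  apply (filterlim_plus (V := C_NormedModule)). }
replace (plus (G := C_NormedModule) (RtoC 0) l) with l in H1
  by (change (l = (0 + l)%C); ring).
eapply filterlim_ext; [|exact H1].
intros n. change ((u n - l + l)%C = u n). ring.
Qed.

Lemma Cmod_ge_Re (z : C) : Re z <= Cmod z.
Proof. eapply Rle_trans; [apply Rle_abs | apply re_le_Cmod]. Qed.

Lemma Re_pos_neq0 (z : C) : 0 < Re z -> z <> 0.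
Proof. intros H ->. simpl in H. lra. Qed.

(** * Continued fractions with unit partial numerators *)

Section BoundedRemainder.

Variables (b : nat -> C) (d : nat -> R).
Hypothesis d_pos : forall n, 0 < d n.
(* Monotonicity serves to compare two consecutive increments of the energy. *)
Hypothesis d_dec : forall n, d (S n) <= d n.
Hypothesis d_le : forall n, d n <= Re (b (S n)).
Hypothesis d_sum : is_lim_seq (sum_n d) p_infty.

Let ones : nat -> C := fun _ => RtoC 1.
(* B', A' are the shifted sequences B_(n-1), A_(n-1), which also make sense
   for n = 0. *)
Let B (n : nat) : C := cf_den ones b n.
Let B' (n : nat) : C := snd (three_term ones b 1 0 n).
Let A (n : nat) : C := cf_num ones b n.
Let A' (n : nat) : C := snd (three_term ones b (b 0%nat) 1 n).

Definition energy (n : nat) : R := Re (B n * Cconj (B' n))%C.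

Lemma den_step (n : nat) : B (S n) = (b (S n) * B n + B' n)%C /\ B' (S n) = B n.
Proof.
unfold B, B', cf_den. simpl.
destruct (three_term ones b 1 0 n) as [x y]. unfold ones. simpl. split; [ring | reflexivity].
Qed.

Lemma num_step (n : nat) : A (S n) = (b (S n) * A n + A' n)%C /\ A' (S n) = A n.
Proof.
unfold A, A', cf_num. simpl.
destruct (three_term ones b (b 0%nat) 1 n) as [x y]. unfold ones. simpl. split; [ring | reflexivity].
Qed.

(** In B_(n+1) conj B_n = b_(n+1) |B_n|^2 + B_(n-1) conj B_n the last summand
    is the conjugate of B_n conj B_(n-1), so it has the same real part. *)
Lemma energy_step (n : nat) : energy (S n) = energy n + Re (b (S n)) * Cmod (B n) ^ 2.
Proof.
unfold energy. destruct (den_step n) as [-> ->].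
rewrite Cmod2_alt.
destruct (b (S n)), (B n), (B' n). simpl. ring.
Qed.

Lemma energy_le_mod (n : nat) : energy n <= Cmod (B n) * Cmod (B' n).
Proof.
unfold energy. rewrite <- (Cmod_conj (B' n)), <- Cmod_mult.
apply Cmod_ge_Re.
Qed.

Lemma energy_mono (n : nat) : energy n + d n * Cmod (B n) ^ 2 <= energy (S n).
Proof.
rewrite energy_step. pose proof (d_le n). pose proof (pow2_ge_0 (Cmod (B n))).
apply Rplus_le_compat_l, Rmult_le_compat_r; assumption.
Qed.

Lemma energy_0 : energy 0 = 0.
Proof. unfold energy, B, B', cf_den. simpl. ring. Qed.

Lemma energy_ge (n : nat) : d 0%nat <= energy (S n).
Proof.
induction n as [|n IH].
- pose proof (energy_mono 0) as H. rewrite energy_0 in H.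
  unfold B, cf_den in H. simpl in H. rewrite Cmod_1 in H. lra.
- pose proof (energy_mono (S n)) as H.
  pose proof (pow2_ge_0 (Cmod (B (S n)))). pose proof (d_pos (S n)). nra.
Qed.

(** The increments d_n |B_n|^2 and d_(n+1) |B_(n+1)|^2 cannot both be small:
    by the arithmetic-geometric inequality their sum is at least
    2 d_(n+1) |B_n B_(n+1)|, and this product is bounded below by the energy. *)
Lemma energy_two_steps (n : nat) :
  energy n + 2 * d 0%nat * d (S n) <= energy (S (S n)).
Proof.
pose proof (energy_mono n) as H1. pose proof (energy_mono (S n)) as H2.
pose proof (energy_le_mod (S n)) as H3. destruct (den_step n) as [_ HB].
rewrite HB in H3.
pose proof (energy_ge n) as H4. pose proof (d_dec n). pose proof (d_pos (S n)).
set (x := Cmod (B n)) in *. set (y := Cmod (B (S n))) in *.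
assert (0 <= (x - y) ^ 2) by apply pow2_ge_0.
assert (d (S n) * x ^ 2 <= d n * x ^ 2)
  by (apply Rmult_le_compat_r; [apply pow2_ge_0 | assumption]).
assert (d (S n) * (2 * d 0%nat) <= d (S n) * (x ^ 2 + y ^ 2))
  by (apply Rmult_le_compat_l; nra).
nra.
Qed.

Lemma energy_sum (n : nat) :
  2 * d 0%nat * (sum_n d n - d 0%nat) <= energy (S n) + energy n.
Proof.
induction n as [|n IH].
- rewrite sum_O, energy_0. pose proof (energy_ge 0). pose proof (d_pos 0). lra.
- rewrite sum_Sn. pose proof (energy_two_steps n).
  change (plus (sum_n d n) (d (S n))) with (sum_n d n + d (S n)). lra.
Qed.

Lemma energy_lim : is_lim_seq (fun n => energy (S n)) p_infty.
Proof.
pose proof (d_pos 0) as Hd.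
apply is_lim_seq_le_p_loc with (u := fun n => d 0%nat * (sum_n d n - d 0%nat)).
- exists 0%nat. intros n _. pose proof (energy_sum n). pose proof (energy_mono n).
  pose proof (d_pos n). pose proof (pow2_ge_0 (Cmod (B n))). nra.
- eapply is_lim_seq_mult; [apply is_lim_seq_const | |].
  + eapply is_lim_seq_minus; [exact d_sum | apply is_lim_seq_const | reflexivity].
  + simpl. unfold is_Rbar_mult, Rbar_mult'. destruct (Rle_dec 0 (d 0%nat)); [|lra].
    destruct (Rle_lt_or_eq_dec 0 (d 0%nat) r); [reflexivity | lra].
Qed.

Lemma wronskian (n : nat) : Cmod (A n * B' n - A' n * B n)%C = 1.
Proof.
induction n as [|n IH].
- unfold A, A', B, B', cf_num, cf_den. simpl.
  replace (b 0%nat * 0 - 1 * 1)%C with (- (1))%C by ring.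
  rewrite Cmod_opp. apply Cmod_1.
- destruct (num_step n) as [-> ->], (den_step n) as [-> ->].
  rewrite <- IH, <- Cmod_opp. f_equal. ring.
Qed.

Variables (f : C) (K : R).
Hypothesis rem_bound : forall n, Cmod (A n - f * B n)%C <= K.

(** Both factors of a product with positive real part are nonzero; this covers
    all B_n, as B_n occurs in the energy at n+1. *)
Lemma den_neq0 (n : nat) : B n <> 0.
Proof.
intros H0. pose proof (energy_ge n) as H. unfold energy in H.
destruct (den_step n) as [_ HB']. rewrite HB', H0 in H.
pose proof (d_pos 0). unfold Cmult, Cconj in H. simpl in H. lra.
Qed.

(** The energy bounds |B_n B_(n+1)| from below, so one of the two factors is at
    least L. If |B_(n+1)| is, the remainder divided by it is at most K/L; if
    |B_n| is, the same holds for the previous convergent, and passing from one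
    convergent to the next costs 1/|B_n B_(n+1)| <= 1/L^2 <= 1/L. *)
Lemma convergent_error (n : nat) (L : R) :
  1 <= L -> L ^ 2 <= energy (S n) -> Cmod (A (S n) / B (S n) - f)%C <= (K + 1) / L.
Proof.
intros HL HE.
pose proof (den_neq0 n) as Hn. pose proof (den_neq0 (S n)) as Hs.
pose proof (energy_le_mod (S n)) as HM. destruct (den_step n) as [_ HB'].
rewrite HB' in HM.
assert (H0 : forall m, Cmod (A m / B m - f)%C = Cmod (A m - f * B m)%C / Cmod (B m)).
{ intros m. pose proof (den_neq0 m). rewrite <- Cmod_div by assumption.
  f_equal. now field. }
pose proof (proj1 (Cmod_gt_0 _) Hn) as Pn. pose proof (proj1 (Cmod_gt_0 _) Hs) as Ps.
assert (HK : 0 <= K) by (eapply Rle_trans; [apply Cmod_ge_0 | apply (rem_bound 0)]).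
assert (Hq : forall m, L <= Cmod (B m) -> Cmod (A m / B m - f)%C <= K / L).
{ intros m Hm. rewrite H0. unfold Rdiv.
  apply Rmult_le_compat; [apply Cmod_ge_0 | | apply rem_bound |].
  - apply Rlt_le, Rinv_0_lt_compat. lra.
  - apply Rinv_le_contravar; lra. }
assert (HLi : 0 < / L) by (apply Rinv_0_lt_compat; lra).
replace ((K + 1) / L) with (K / L + / L) by (field; lra).
destruct (Rle_lt_dec L (Cmod (B (S n)))) as [Hc|Hc].
- pose proof (Hq _ Hc). lra.
- assert (Hc' : L <= Cmod (B n)) by nra.
  replace (A (S n) / B (S n) - f)%C
    with ((A n / B n - f) + (A (S n) * B' (S n) - A' (S n) * B (S n)) / (B (S n) * B n))%C
    by (rewrite HB', (proj2 (num_step n)); now field).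
  eapply Rle_trans; [apply Cmod_triangle|].
  apply Rplus_le_compat; [now apply Hq|].
  rewrite Cmod_div, wronskian, Cmod_mult by now apply Cmult_neq_0.
  unfold Rdiv. rewrite Rmult_1_l. apply Rinv_le_contravar; nra.
Qed.

(** A criterion in the spirit of Pincherle's theorem: as the energy forces the
    denominators to grow, a bounded solution A_n - f B_n of the three-term
    recurrence identifies the value f. *)
Lemma contfrac_of_bounded_remainder : is_contfrac ones b f.
Proof.
split; [exists 0%nat; intros n _; apply den_neq0 |].
pose proof energy_lim as HE.
assert (Hs : is_lim_seq (fun n => sqrt (energy n)) p_infty).
{ apply is_lim_seq_incr_1.
  exact (filterlim_comp _ _ _ _ sqrt _ _ _ HE filterlim_sqrt_p). }
apply C_lim_of_bound with (e := fun n => (K + 1) / sqrt (energy n)).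
- apply is_lim_seq_ext with (u := fun n => (K + 1) * / sqrt (energy n)); [reflexivity|].
  replace (Finite 0) with (Rbar_mult (K + 1) 0) by (simpl; f_equal; ring).
  apply is_lim_seq_scal_l.
  replace (Finite 0) with (Rbar_inv p_infty) by reflexivity.
  apply is_lim_seq_inv; [exact Hs | discriminate].
- destruct (Hs (fun y => 1 < y)) as [N HN]; [now exists 1|].
  exists (S N). intros [|n] Hn; [lia|].
  apply convergent_error.
  + apply Rlt_le, HN. lia.
  + rewrite pow2_sqrt; [lra|]. pose proof (energy_ge n). pose proof (d_pos 0). lra.
Qed.

End BoundedRemainder.

(** * Sequences of polynomial growth and their series *)

(** Growth exponents may be negative, and k + 1 replaces k to avoid 0^p. *)
Definition poly_bound (p : Z) (u : nat -> C) : Prop :=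
  exists D : R, forall k, Cmod (u k) <= D * powerRZ (INR k + 1) p.

Lemma poly_bound_mult (p q : Z) (u v : nat -> C) :
  poly_bound p u -> poly_bound q v -> poly_bound (p + q) (fun k => u k * v k)%C.
Proof.
intros [D HD] [E HE]. exists (D * E). intros k. pose proof (pos_INR k).
rewrite Cmod_mult, powerRZ_add by lra.
replace (D * E * (powerRZ (INR k + 1) p * powerRZ (INR k + 1) q))
  with ((D * powerRZ (INR k + 1) p) * (E * powerRZ (INR k + 1) q)) by ring.
apply Rmult_le_compat; auto; apply Cmod_ge_0.
Qed.

Lemma poly_bound_plus (p : Z) (u v : nat -> C) :
  poly_bound p u -> poly_bound p v -> poly_bound p (fun k => u k + v k)%C.
Proof.
intros [D HD] [E HE]. exists (D + E). intros k.
eapply Rle_trans; [apply Cmod_triangle|]. specialize (HD k). specialize (HE k). lra.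
Qed.

Lemma poly_bound_weaken (p q : Z) (u : nat -> C) :
  (p <= q)%Z -> poly_bound p u -> poly_bound q u.
Proof.
intros Hpq [D HD]. exists D. intros k. pose proof (pos_INR k).
assert (HD0 : 0 <= D).
{ pose proof (Rle_trans _ _ _ (Cmod_ge_0 _) (HD 0%nat)) as H0.
  simpl in H0. rewrite Rplus_0_l, powerRZ_R1 in H0. lra. }
eapply Rle_trans; [apply HD|]. apply Rmult_le_compat_l; [exact HD0|].
replace q with (p + (q - p))%Z by lia. rewrite powerRZ_add by lra.
rewrite <- (Rmult_1_r (powerRZ _ p)) at 1.
apply Rmult_le_compat_l; [apply powerRZ_le; lra|].
rewrite <- (Z2Nat.id (q - p)), <- pow_powerRZ by lia. apply pow_R1_Rle. lra.
Qed.

Lemma poly_bound_const (c : C) : poly_bound 0 (fun _ => c).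
Proof. exists (Cmod c). intros k. simpl. lra. Qed.

Lemma poly_bound_id : poly_bound 1 (fun k => RtoC (INR k)).
Proof.
exists 1. intros k. pose proof (pos_INR k). rewrite Cmod_R, Rabs_pos_eq by lra.
rewrite powerRZ_1. lra.
Qed.

Lemma poly_bound_ext (p : Z) (u v : nat -> C) :
  (forall k, u k = v k) -> poly_bound p u -> poly_bound p v.
Proof. intros He [D HD]. exists D. intros k. rewrite <- He. apply HD. Qed.

Lemma poly_bound_inv (a : C) : 0 < Re a -> poly_bound (-1) (fun k => / (a + INR k))%C.
Proof.
intros Ha. exists (/ Rmin (Re a) 1). intros k. pose proof (pos_INR k).
assert (Hre : Re (a + INR k)%C = Re a + INR k) by reflexivity.
assert (0 < Rmin (Re a) 1) by (apply Rmin_glb_lt; lra).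
pose proof (Rmin_l (Re a) 1). pose proof (Rmin_r (Re a) 1).
rewrite Cmod_inv by (apply Re_pos_neq0; lra).
change (powerRZ (INR k + 1) (-1)) with (/ ((INR k + 1) * 1)).
rewrite Rmult_1_r, <- Rinv_mult. apply Rinv_le_contravar; [nra|].
eapply Rle_trans; [|apply Cmod_ge_Re]. rewrite Hre. nra.
Qed.

Lemma poly_bound_quadratic (a b c : C) :
  poly_bound 2 (fun k => a * INR k ^ 2 + b * INR k + c)%C.
Proof.
repeat apply poly_bound_plus.
- apply (poly_bound_mult 0 2); [apply poly_bound_const|].
  apply poly_bound_ext with (u := fun k => (INR k * INR k)%C).
  + intros k. ring.
  + apply (poly_bound_mult 1 1); apply poly_bound_id.
- apply (poly_bound_weaken (0 + 1)); [lia|].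
  apply poly_bound_mult; [apply poly_bound_const | apply poly_bound_id].
- apply (poly_bound_weaken 0); [lia | apply poly_bound_const].
Qed.

Lemma is_lim_seq_inv_succ : is_lim_seq (fun k => / (INR k + 1)) 0.
Proof.
apply is_lim_seq_ext with (u := fun k => / INR (S k)).
- intros k. now rewrite S_INR.
- replace (Finite 0) with (Rbar_inv p_infty) by reflexivity.
  apply is_lim_seq_inv; [|discriminate].
  apply (is_lim_seq_incr_1 INR), is_lim_seq_INR.
Qed.

Lemma poly_bound_lim (u : nat -> C) :
  poly_bound (-1) u -> filterlim u eventually (locally (T := C_UniformSpace) (RtoC 0)).
Proof.
intros [D HD]. apply C_lim_of_bound with (e := fun k => D * / (INR k + 1)).
- replace (Finite 0) with (Rbar_mult D 0) by (simpl; f_equal; ring).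
  apply is_lim_seq_scal_l, is_lim_seq_inv_succ.
- exists 0%nat. intros k _. replace (u k - 0)%C with (u k) by ring.
  specialize (HD k). change (powerRZ (INR k + 1) (-1)) with (/ ((INR k + 1) * 1)) in HD.
  now rewrite Rmult_1_r in HD.
Qed.

Lemma is_series_telescope {K : AbsRing} {V : NormedModule K} (G : nat -> V) :
  filterlim G eventually (locally (T := V) zero) ->
  is_series (fun k => minus (G k) (G (S k))) (G 0%nat).
Proof.
intros HG.
apply filterlim_ext with (f := fun n => minus (G 0%nat) (G (S n))).
{ induction x as [|n IH].
  - now rewrite sum_O.
  - rewrite sum_Sn, <- IH. exact (minus_trans (G := V) (G (S n)) _ _). }
assert (H : filterlim (fun n => plus (G 0%nat) (opp (G (S n)))) eventually
              (locally (T := V) (plus (G 0%nat) (opp zero)))).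
{ apply (filterlim_comp_2 (G := locally (T := V) (G 0%nat))
           (H := locally (T := V) (opp zero))).
  - apply filterlim_const.
  - refine (filterlim_comp nat V V (fun n => G (S n)) opp eventually (locally (T := V) zero)
              (locally (T := V) (opp zero)) _ (filterlim_opp (V := V) zero)).
    refine (filterlim_comp nat nat V S G eventually eventually _ _ HG).
    apply eventually_subseq; intros n; lia.
  - apply (filterlim_plus (V := V)). }
rewrite opp_zero, plus_zero_r in H. exact H.
Qed.

Lemma ex_series_inv_sq : ex_series (fun k => / ((INR k + 1) * (INR k + 1))).
Proof.
apply (ex_series_le (V := R_CompleteNormedModule)) with
  (b := fun k => scal 2 (minus (/ (INR k + 1)) (/ (INR (S k) + 1)))).
- intros k. pose proof (pos_INR k).
  change (Rabs (/ ((INR k + 1) * (INR k + 1))) <= 2 * (/ (INR k + 1) - / (INR (S k) + 1))).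
  rewrite S_INR, Rabs_pos_eq by (apply Rlt_le, Rinv_0_lt_compat; nra).
  replace (2 * (/ (INR k + 1) - / (INR k + 1 + 1)))
    with (/ ((INR k + 1) * (INR k + 1 + 1) / 2)) by (field; lra).
  apply Rinv_le_contravar; nra.
- exists (scal 2 (/ (INR 0 + 1))).
  apply (is_series_scal_l (V := R_NormedModule) 2).
  apply (is_series_telescope (V := R_NormedModule) (fun k => / (INR k + 1))).
  exact is_lim_seq_inv_succ.
Qed.

Lemma poly_bound_summable (u : nat -> C) :
  poly_bound (-2) u -> ex_series (fun k => Cmod (u k)).
Proof.
intros [D HD].
apply (ex_series_le (V := R_CompleteNormedModule)) with
  (b := fun k => scal D (/ ((INR k + 1) * (INR k + 1)))).
- intros k. change (Rabs (Cmod (u k)) <= D * / ((INR k + 1) * (INR k + 1))).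
  rewrite Rabs_pos_eq by apply Cmod_ge_0. specialize (HD k).
  change (powerRZ (INR k + 1) (-2)) with (/ ((INR k + 1) * ((INR k + 1) * 1))) in HD.
  now rewrite Rmult_1_r in HD.
- apply (ex_series_scal_l (V := R_NormedModule)), ex_series_inv_sq.
Qed.

Lemma CSeries_correct (u : nat -> C) :
  ex_series (fun k => Cmod (u k)) -> is_series (V := C_NormedModule) u (CSeries u).
Proof.
intros Hu.
destruct (ex_series_le (V := C_CompleteNormedModule) u (fun k => Cmod (u k))) as [l Hl].
- intros k. change (Cmod (u k) <= Cmod (u k)). apply Rle_refl.
- exact Hu.
- now rewrite (CSeries_unique _ _ Hl).
Qed.

Lemma is_series_telescope_poly (u G : nat -> C) :
  poly_bound (-1) G -> (forall k, u k = (G k - G (S k))%C) ->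
  is_series (V := C_NormedModule) u (G 0%nat).
Proof.
intros HG Hu. eapply is_series_ext.
- intros k. symmetry. apply Hu.
- apply (is_series_telescope (V := C_NormedModule)). now apply poly_bound_lim.
Qed.

Lemma is_series_unique_C (u : nat -> C) (l l' : C) :
  is_series (V := C_NormedModule) u l -> is_series (V := C_NormedModule) u l' -> l = l'.
Proof. intros H H'. now rewrite <- (CSeries_unique _ _ H), (CSeries_unique _ _ H'). Qed.

(** The factor 2 comes from estimating the real and imaginary parts
    separately. *)
Lemma CSeries_dominated (u v : nat -> C) :
  (forall k, Cmod (u k) <= Re (v k)) ->
  ex_series (fun k => Cmod (v k)) ->
  Cmod (CSeries u) <= 2 * Re (CSeries v).
Proof.
intros Huv Hs.
assert (Hv : ex_series (fun k => Re (v k))).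
{ apply (ex_series_le (V := R_CompleteNormedModule)) with (b := fun k => Cmod (v k));
    [|exact Hs].
  intros k. apply re_le_Cmod. }
eapply Rle_trans; [apply Cmod_le_Rabs|].
assert (Hp : forall p : C -> R, (forall z, Rabs (p z) <= Cmod z) ->
  Rabs (Series (fun k => p (u k))) <= Series (fun k => Re (v k))).
{ intros p Hp.
  assert (Hk : forall k, 0 <= Rabs (p (u k)) <= Re (v k)).
  { intros k. split; [apply Rabs_pos | eapply Rle_trans; [apply Hp | apply Huv]]. }
  eapply Rle_trans; [apply Series_Rabs | now apply Series_le].
  apply (ex_series_le (V := R_CompleteNormedModule)) with (b := fun k => Re (v k));
    [|exact Hv].
  intros k. change (Rabs (Rabs (p (u k))) <= Re (v k)).
  rewrite Rabs_Rabsolu. apply Hk. }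
assert (H1 := Hp Re re_le_Cmod).
assert (H2 := Hp Im (fun z => Rle_trans _ _ _ (Rmax_r _ _) (Rmax_Cmod z))).
simpl in *. lra.
Qed.

(** * The kernel and its contiguous relations *)

Definition pole (M : C) (n : nat) : C := ((/ (M + INR n)) ^ 2)%C.

Definition kern_ratio (i k : nat) : R :=
  (INR i + 1 + INR k) * (INR i + 2) ^ 2 / (INR i + 1).

(** With m = i + 1 and t = M + k this is
    binomial(m-1+k, k) (m! / (t (t+1) ... (t+m)))^2, the k-th term of J_m. The
    recursion on i records the quotient of the terms for m + 1 and m. *)
Fixpoint kern (M : C) (i k : nat) : C :=
  match i with
  | O => (pole M k * pole M (S k))%C
  | S i' => (kern M i' k * (kern_ratio i' k * pole M (S (S (i' + k)))))%C
  end.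

(** The integral J_(i+1). *)
Definition kern_sum (M : C) (i : nat) : C := CSeries (kern M i).

Ltac pos_re :=
  apply Re_pos_neq0; unfold Re in *; simpl;
  repeat match goal with
  | n : nat |- _ =>
      lazymatch goal with
      | H : 0 <= INR n |- _ => fail
      | _ => pose proof (pos_INR n)
      end
  end; lra.

Lemma RtoC_kern_ratio (i k : nat) :
  RtoC (kern_ratio i k)
  = ((INR i + 1 + INR k) * (INR i + 2) ^ 2 / (INR i + 1))%C.
Proof.
pose proof (pos_INR i). unfold kern_ratio.
rewrite RtoC_div, RtoC_mult, RtoC_pow, !RtoC_plus by lra. reflexivity.
Qed.

Ltac kern_field :=
  cbn [kern]; unfold pole; rewrite ?RtoC_kern_ratio, ?S_INR, ?plus_INR, ?S_INR, ?RtoC_plus;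
  simpl (INR 0); field; repeat split; pos_re.

Lemma kern_succ (M : C) (i k : nat) : 0 < Re M ->
  kern M i (S k) = (kern M i k *
    ((INR i + 1 + INR k) * (M + INR k) ^ 2 /
     ((INR k + 1) * (M + INR k + INR i + 2) ^ 2)))%C.
Proof.
intros HM. induction i as [|i IH].
- kern_field.
- cbn [kern]. rewrite IH. generalize (kern M i k). intros z. kern_field.
Qed.

(** The function G whose differences realise the recurrence between J_(m-1),
    J_m and J_(m+1), for m = i + 2. It comes from Zeilberger's method: let
    T(k) = [kern M (S i) k] be the k-th term of J_m. For the ansatz
    G(k) = k q(k) T(k) / (k + m - 1) the recurrence becomes a linear system for
    the coefficients of q, which a quadratic polynomial solves. The factor
    after q, times [kern M i k], is T(k) / (k + m - 1). *)
Definition cert (M : C) (i k : nat) : C :=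
  let m := (INR i + 2)%C in
  (INR k *
   ((- (m - 1) * INR k ^ 2 + (2 * M - 3 * m * (m - 1)) * INR k
     + ((m + 1) * M ^ 2 + 4 * m * M - m * (2 * m ^ 2 - 3 * m - 1)))
    / (m ^ 2 * (m + 1))) *
   (m ^ 2 / (INR i + 1) * pole M (S (S (i + k)))) * kern M i k)%C.

Lemma kern_cert (M : C) (i k : nat) : 0 < Re M ->
  (kern M (S (S i)) k - kern M i k
   + 2 * M * (2 * INR i + 5) / ((INR i + 2) * (INR i + 3)) * kern M (S i) k
   = cert M i k - cert M i (S k))%C.
Proof.
intros HM. unfold cert. rewrite kern_succ by exact HM. cbn [kern].
generalize (kern M i k). intros z. kern_field.
Qed.

(** The certificate for the recurrence between J_0, J_1 and J_2. As J_0 = 1/M^2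
    is not given by a series, it enters as the boundary term at k = 0. *)
Definition cert0 (M : C) (k : nat) : C :=
  ((M * INR k + (M + 1) ^ 2) * kern M 0 k)%C.

Lemma kern_cert0 (M : C) (k : nat) : 0 < Re M ->
  (kern M 1 k + 3 * M * kern M 0 k = cert0 M k - cert0 M (S k))%C.
Proof.
intros HM. unfold cert0. rewrite kern_succ by exact HM. kern_field.
Qed.

Lemma poly_bound_pole (M : C) (i : nat) : 0 < Re M ->
  poly_bound (-2) (fun k => pole M (i + k)).
Proof.
intros HM. apply poly_bound_ext with
  (u := fun k => (/ (M + INR i + INR k) * / (M + INR i + INR k))%C).
- intros k. unfold pole. rewrite plus_INR, RtoC_plus. field. pos_re.
- pose proof (pos_INR i).
  apply (poly_bound_mult (-1) (-1)); apply poly_bound_inv; unfold Re in *; simpl; lra.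
Qed.

Lemma poly_bound_kern (M : C) (i : nat) : 0 < Re M -> poly_bound (-4) (kern M i).
Proof.
intros HM. induction i as [|i IH].
- exact (poly_bound_mult (-2) (-2) _ _ (poly_bound_pole M 0 HM) (poly_bound_pole M 1 HM)).
- apply (poly_bound_weaken (-4 + (1 + -2))); [lia|].
  apply (poly_bound_mult (-4) (1 + -2)); [exact IH|].
  apply (poly_bound_mult 1 (-2)); [|exact (poly_bound_pole M (S (S i)) HM)].
  apply poly_bound_ext with
    (u := fun k => ((INR i + 1 + INR k) * ((INR i + 2) ^ 2 / (INR i + 1)))%C).
  + intros k. rewrite RtoC_kern_ratio. field. pos_re.
  + apply (poly_bound_mult 1 0); [|apply poly_bound_const].
    apply poly_bound_plus; [|apply poly_bound_id].
    apply (poly_bound_weaken 0); [lia | apply poly_bound_const].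
Qed.

Lemma poly_bound_cert (M : C) (i : nat) : 0 < Re M -> poly_bound (-1) (cert M i).
Proof.
intros HM. unfold cert. cbv zeta.
apply (poly_bound_weaken (((1 + (2 + 0)) + (0 + -2)) + -4)); [lia|].
apply poly_bound_mult; [|now apply poly_bound_kern].
apply poly_bound_mult.
- apply poly_bound_mult; [apply poly_bound_id|].
  apply poly_bound_mult; [apply poly_bound_quadratic | apply poly_bound_const].
- apply poly_bound_mult; [apply poly_bound_const | exact (poly_bound_pole M (S (S i)) HM)].
Qed.

Lemma poly_bound_cert0 (M : C) : 0 < Re M -> poly_bound (-1) (cert0 M).
Proof.
intros HM. apply (poly_bound_weaken ((0 + 1) + -4)); [lia|].
apply poly_bound_mult; [|now apply poly_bound_kern].
apply poly_bound_plus.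
- apply poly_bound_mult; [apply poly_bound_const | apply poly_bound_id].
- apply (poly_bound_weaken 0); [lia | apply poly_bound_const].
Qed.

Lemma kern_summable (M : C) (i : nat) : 0 < Re M -> ex_series (fun k => Cmod (kern M i k)).
Proof.
intros HM. apply poly_bound_summable, (poly_bound_weaken (-4)); [lia|].
now apply poly_bound_kern.
Qed.

Lemma kern_sum_correct (M : C) (i : nat) : 0 < Re M ->
  is_series (V := C_NormedModule) (kern M i) (kern_sum M i).
Proof. intros HM. now apply CSeries_correct, kern_summable. Qed.

Lemma kern_sum_rec (M : C) (i : nat) : 0 < Re M ->
  kern_sum M (S (S i)) = (kern_sum M i
   - 2 * M * (2 * INR i + 5) / ((INR i + 2) * (INR i + 3)) * kern_sum M (S i))%C.
Proof.
intros HM.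
set (c := (2 * M * (2 * INR i + 5) / ((INR i + 2) * (INR i + 3)))%C).
assert (H : is_series (V := C_NormedModule)
  (fun k => kern M (S (S i)) k - kern M i k + c * kern M (S i) k)%C
  (kern_sum M (S (S i)) - kern_sum M i + c * kern_sum M (S i))%C).
{ apply (is_series_plus (V := C_NormedModule)).
  - apply (is_series_minus (V := C_NormedModule)); now apply kern_sum_correct.
  - apply (is_series_scal (V := C_NormedModule)); now apply kern_sum_correct. }
assert (H' := is_series_telescope_poly _ _ (poly_bound_cert M i HM)
                (fun k => kern_cert M i k HM)).
pose proof (is_series_unique_C _ _ _ H H') as E.
replace (cert M i 0) with (RtoC 0) in E by (unfold cert; simpl; ring).
replace (kern_sum M (S (S i)))
  with ((kern_sum M (S (S i)) - kern_sum M i + c * kern_sum M (S i))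
        + kern_sum M i - c * kern_sum M (S i))%C by ring.
rewrite E. ring.
Qed.

Lemma kern_sum_1 (M : C) : 0 < Re M ->
  kern_sum M 1 = (/ M ^ 2 - 3 * M * kern_sum M 0)%C.
Proof.
intros HM.
assert (H : is_series (V := C_NormedModule)
  (fun k => kern M 1 k + 3 * M * kern M 0 k)%C
  (kern_sum M 1 + 3 * M * kern_sum M 0)%C).
{ apply (is_series_plus (V := C_NormedModule)); [now apply kern_sum_correct|].
  apply (is_series_scal (V := C_NormedModule)); now apply kern_sum_correct. }
assert (H' := is_series_telescope_poly _ _ (poly_bound_cert0 M HM)
                (fun k => kern_cert0 M k HM)).
pose proof (is_series_unique_C _ _ _ H H') as E.
replace (kern_sum M 1)
  with ((kern_sum M 1 + 3 * M * kern_sum M 0) - 3 * M * kern_sum M 0)%C by ring.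
rewrite E. unfold cert0. kern_field.
Qed.

(** * Boundedness of the remainders *)

Lemma pole_dominated (M : C) (n : nat) : 0 < Re M ->
  exists r, 0 <= r /\ pole (Re M) n = RtoC r /\ Cmod (pole M n) <= r.
Proof.
intros HM. pose proof (pos_INR n).
exists ((/ (Re M + INR n)) ^ 2). unfold pole.
assert (0 < / (Re M + INR n)) by (apply Rinv_0_lt_compat; lra).
split; [apply pow2_ge_0|]. split.
- rewrite RtoC_pow, RtoC_inv, RtoC_plus by lra. reflexivity.
- assert (Hre : Re (M + INR n)%C = Re M + INR n) by reflexivity.
  rewrite Cmod_pow, Cmod_inv by (apply Re_pos_neq0; lra).
  pose proof (Cmod_ge_Re (M + INR n)%C).
  apply pow_incr. split.
  + apply Rlt_le, Rinv_0_lt_compat. lra.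
  + apply Rinv_le_contravar; lra.
Qed.

Lemma kern_ratio_ge0 (i k : nat) : 0 <= kern_ratio i k.
Proof.
pose proof (pos_INR i). pose proof (pos_INR k). unfold kern_ratio.
apply Rmult_le_pos; [apply Rmult_le_pos; [lra | apply pow2_ge_0]|].
apply Rlt_le, Rinv_0_lt_compat. lra.
Qed.

(** Replacing M by its real part decreases |t + j| in every pole, while the
    remaining factors are positive and independent of M. *)
Lemma kern_dominated (M : C) (i k : nat) : 0 < Re M ->
  Cmod (kern M i k) <= Re (kern (Re M) i k).
Proof.
intros HM.
enough (H : exists r, 0 <= r /\ kern (Re M) i k = RtoC r /\ Cmod (kern M i k) <= r)
  by (destruct H as (r & _ & -> & H); exact H).
induction i as [|i (r & Hr & Er & Hle)]; cbn [kern].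
- destruct (pole_dominated M k HM) as (r & Hr & -> & Hle).
  destruct (pole_dominated M (S k) HM) as (r' & Hr' & -> & Hle').
  exists (r * r'). split; [now apply Rmult_le_pos|].
  split; [now rewrite RtoC_mult|].
  rewrite Cmod_mult. apply Rmult_le_compat; auto; apply Cmod_ge_0.
- destruct (pole_dominated M (S (S (i + k))) HM) as (r' & Hr' & -> & Hle').
  pose proof (kern_ratio_ge0 i k) as Hc.
  exists (r * (kern_ratio i k * r')). rewrite Er.
  split; [apply Rmult_le_pos; [exact Hr | now apply Rmult_le_pos]|].
  split; [now rewrite !RtoC_mult|].
  rewrite !Cmod_mult, Cmod_R, Rabs_pos_eq by exact Hc.
  apply Rmult_le_compat; auto; [apply Cmod_ge_0| |].
  + apply Rmult_le_pos; [exact Hc | apply Cmod_ge_0].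
  + now apply Rmult_le_compat_l.
Qed.

Lemma kern_sum_dominated (M : C) (i : nat) : 0 < Re M ->
  Cmod (kern_sum M i) <= 2 * Re (kern_sum (Re M) i).
Proof.
intros HM. apply CSeries_dominated.
- intros k. now apply kern_dominated.
- now apply kern_summable.
Qed.

(** For a real parameter the coefficient in the recurrence is positive and so
    are the sums. *)
Lemma kern_sum_real_decr (x : R) (i : nat) : 0 < x ->
  Re (kern_sum x (S (S i))) <= Re (kern_sum x i).
Proof.
intros Hx. pose proof (pos_INR i) as Hi.
rewrite kern_sum_rec by exact Hx.
set (c := 2 * x * (2 * INR i + 5) / ((INR i + 2) * (INR i + 3))).
assert (Hc : 0 <= c).
{ apply Rmult_le_pos; [nra|]. apply Rlt_le, Rinv_0_lt_compat. nra. }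
replace (2 * x * (2 * INR i + 5) / ((INR i + 2) * (INR i + 3)))%C with (RtoC c).
- pose proof (kern_sum_dominated x (S i) Hx) as H.
  pose proof (Cmod_ge_0 (kern_sum x (S i))).
  change (RtoC (Re (RtoC x))) with (RtoC x) in H.
  simpl in *. nra.
- unfold c. rewrite RtoC_div by nra.
  now rewrite !RtoC_mult, !RtoC_plus, !RtoC_mult.
Qed.

Lemma kern_sum_bounded (M : C) : 0 < Re M ->
  exists K, forall i, Cmod (kern_sum M i) <= K.
Proof.
intros HM. set (s := fun i => Re (kern_sum (Re M) i)).
assert (Hs : forall i, 0 <= s i).
{ intros i. pose proof (kern_sum_dominated M i HM). pose proof (Cmod_ge_0 (kern_sum M i)).
  unfold s. lra. }
assert (H : forall i, s i <= s 0%nat + s 1%nat /\ s (S i) <= s 0%nat + s 1%nat).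
{ pose proof (Hs 0%nat). pose proof (Hs 1%nat).
  induction i as [|i [IH1 IH2]]; [lra|]. split; [exact IH2|].
  eapply Rle_trans; [|exact IH1]. now apply kern_sum_real_decr. }
exists (2 * (s 0%nat + s 1%nat)). intros i.
pose proof (kern_sum_dominated M i HM). destruct (H i) as [Hi _]. unfold s in *. lra.
Qed.

(** * The Hurwitz zeta function at 2 *)

(** Since 1/(t(t+1)) = 1/t - 1/(t+1), twice the term 1/(t+1)^2 is the kernel
    1/(t(t+1))^2 plus the difference of 2/t - 1/t^2. *)
Lemma lerch_series (M : C) : 0 < Re M ->
  is_series (V := C_NormedModule) (lerch_term 1 2 (M + 1)%C)
    (/ 2 * (kern_sum M 0 + (2 / M - / M ^ 2)))%C.
Proof.
intros HM.
set (G := fun k : nat => (2 * / (M + INR k) - pole M k)%C).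
assert (HG : poly_bound (-1) G).
{ apply poly_bound_plus.
  - apply (poly_bound_mult 0 (-1)); [apply poly_bound_const | now apply poly_bound_inv].
  - apply poly_bound_ext with (u := fun k => (- (1) * pole M (0 + k))%C).
    + intros k. simpl. ring.
    + apply (poly_bound_weaken (0 + -2)); [lia|].
      apply poly_bound_mult; [apply poly_bound_const | now apply poly_bound_pole]. }
replace (2 / M - / M ^ 2)%C with (G 0%nat)
  by (unfold G, pole; simpl (INR 0); field; pos_re).
assert (Ht : forall k, lerch_term 1 2 (M + 1)%C k
                       = (/ 2 * (kern M 0 k + (G k - G (S k))))%C).
{ intros k. unfold lerch_term. rewrite Cpow_1_l.
  (* the exponent, in the form to which [cpower_nat] applies *)
  replace (RtoC 2) with (RtoC (INR 2)) at 1 by (simpl; f_equal; ring).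
  rewrite cpower_nat by pos_re.
  unfold G. kern_field. }
eapply is_series_ext; [intros k; symmetry; apply Ht|].
apply (is_series_scal (V := C_NormedModule)), (is_series_plus (V := C_NormedModule)).
- now apply kern_sum_correct.
- now apply is_series_telescope_poly.
Qed.

(** * The continued fraction *)

Lemma cf_rec (a b : nat -> C) (n : nat) :
  cf_num a b (S (S n)) = (b (S (S n)) * cf_num a b (S n) + a (S (S n)) * cf_num a b n)%C /\
  cf_den a b (S (S n)) = (b (S (S n)) * cf_den a b (S n) + a (S (S n)) * cf_den a b n)%C.
Proof.
unfold cf_num, cf_den. simpl.
destruct (three_term a b (b 0%nat) 1 n), (three_term a b 1 0 n). now split.
Qed.

(** By ln (1 + x) <= x the partial sums dominate c ln (n + 2). *)
Lemma sum_inv_succ_diverges (c : R) : 0 < c ->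
  is_lim_seq (sum_n (fun n => c / (INR n + 1))) p_infty.
Proof.
intros Hc.
assert (Hln : forall n, c * ln (INR (S n) + 1) <= sum_n (fun n => c / (INR n + 1)) n).
{ assert (Hstep : forall n, c * ln (INR (S n) + 1) <= c * ln (INR n + 1) + c / (INR n + 1)).
  { intros n. pose proof (pos_INR n). rewrite S_INR.
    replace (INR n + 1 + 1) with ((INR n + 1) * (1 + / (INR n + 1))) by (field; lra).
    assert (0 < / (INR n + 1)) by (apply Rinv_0_lt_compat; lra).
    rewrite ln_mult by lra.
    assert (ln (1 + / (INR n + 1)) <= / (INR n + 1)).
    { rewrite <- (ln_exp (/ (INR n + 1))) at 2. apply ln_le; [lra | apply exp_ineq1_le]. }
    unfold Rdiv. nra. }
  induction n as [|n IH].
  - rewrite sum_O. pose proof (Hstep 0%nat) as H. simpl (INR 0) in *.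
    rewrite Rplus_0_l, ln_1 in H. rewrite Rplus_0_l. lra.
  - rewrite sum_Sn.
    change (plus ?x ?y) with (x + y).
    pose proof (Hstep (S n)). lra. }
apply is_lim_seq_le_p_loc with (u := fun n => c * ln (INR (S n) + 1)).
- exists 0%nat. intros n _. apply Hln.
- assert (Hlog : is_lim_seq (fun n => ln (INR (S n) + 1)) p_infty).
  { refine (filterlim_comp _ _ _ (fun n => INR (S n) + 1) ln eventually
              (Rbar_locally p_infty) _ _ is_lim_ln_p).
    apply is_lim_seq_le_p_loc with (u := INR); [|apply is_lim_seq_INR].
    exists 0%nat. intros n _. rewrite S_INR. lra. }
  eapply is_lim_seq_mult; [apply is_lim_seq_const | exact Hlog |].
  simpl. unfold is_Rbar_mult, Rbar_mult'. destruct (Rle_dec 0 c) as [Hle|]; [|lra].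
  destruct (Rle_lt_or_eq_dec 0 c Hle); [reflexivity | lra].
Qed.

Section Fraction.

Variables (M : C) (b : nat -> C).
Hypothesis hM : 0 < Re M.
Hypothesis hb : forall n : nat, (1 <= n)%nat ->
  b n = (2 * M * ((2 * INR n + 1) / (INR n * (INR n + 1))))%C.

Let ones : nat -> C := fun _ => RtoC 1.
Let f : C := (b 0%nat + M ^ 2 * kern_sum M 0)%C.

(** Both sides satisfy the same three-term recurrence. They agree at n = 0 by
    the choice of f, and at n = 1 because J_2 = J_0 - b_1 J_1 with
    J_0 = 1/M^2. *)
Lemma contfrac_remainder (n : nat) :
  (cf_num ones b n - f * cf_den ones b n = (- (1)) ^ S n * M ^ 2 * kern_sum M n)%C.
Proof.
enough (H : forall n,
  (cf_num ones b n - f * cf_den ones b n = (- (1)) ^ S n * M ^ 2 * kern_sum M n)%C /\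
  (cf_num ones b (S n) - f * cf_den ones b (S n)
     = (- (1)) ^ S (S n) * M ^ 2 * kern_sum M (S n))%C) by apply H.
clear n. induction n as [|n [IH1 IH2]].
- rewrite kern_sum_1 by exact hM. unfold f, cf_num, cf_den, ones. simpl.
  rewrite (hb 1) by lia. simpl (INR 1). split; [ring | field; pos_re].
- split; [exact IH2|].
  destruct (cf_rec ones b n) as [-> ->].
  replace (b (S (S n)) * cf_num ones b (S n) + ones (S (S n)) * cf_num ones b n
           - f * (b (S (S n)) * cf_den ones b (S n) + ones (S (S n)) * cf_den ones b n))%C
    with (b (S (S n)) * (cf_num ones b (S n) - f * cf_den ones b (S n))
          + (cf_num ones b n - f * cf_den ones b n))%C by (unfold ones; ring).
  rewrite IH1, IH2, kern_sum_rec, hb, !S_INR, !RtoC_plus by (exact hM || lia).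
  cbn [Cpow]. field. repeat split; pos_re.
Qed.

Lemma contfrac_converges : is_contfrac ones b f.
Proof.
destruct (kern_sum_bounded M hM) as [K HK].
(* As b_(n+1) = 2M (1/(n+1) + 1/(n+2)), the first summand gives a minorant. *)
apply contfrac_of_bounded_remainder
  with (d := fun n => 2 * Re M / (INR n + 1)) (K := Cmod M ^ 2 * K).
- intros n. pose proof (pos_INR n). apply Rdiv_lt_0_compat; lra.
- intros n. pose proof (pos_INR n). rewrite S_INR.
  apply Rmult_le_compat_l; [lra|]. apply Rinv_le_contravar; lra.
- intros n. pose proof (pos_INR n) as Hn. rewrite hb by lia.
  replace (2 * M * ((2 * INR (S n) + 1) / (INR (S n) * (INR (S n) + 1))))%C
    with (RtoC (2 / (INR n + 1) + 2 / (INR n + 2)) * M)%C.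
  + replace (Re (RtoC (2 / (INR n + 1) + 2 / (INR n + 2)) * M)%C)
      with (2 * Re M / (INR n + 1) + 2 * Re M / (INR n + 2))
      by (unfold Re; simpl; field; lra).
    assert (0 < 2 * Re M / (INR n + 2)) by (apply Rdiv_lt_0_compat; lra). lra.
  + rewrite RtoC_plus, !RtoC_div, S_INR, !RtoC_plus by lra.
    field. repeat split; pos_re.
- apply sum_inv_succ_diverges. lra.
- intros n. change (Cmod (cf_num ones b n - f * cf_den ones b n)%C <= Cmod M ^ 2 * K).
  rewrite contfrac_remainder, !Cmod_mult, !Cmod_pow, Cmod_opp, Cmod_1, pow1, Rmult_1_l.
  apply Rmult_le_compat_l; [apply pow2_ge_0 | apply HK].
Qed.

End Fraction.

Theorem theorem3 (M : C) (hM : 0 < Re M) (b : nat -> C)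
  (hb0 : b 0%nat = (2 * M - 1)%C)
  (hb : forall n : nat, (1 <= n)%nat ->
     b n = (2 * M * ((2 * INR n + 1) / (INR n * (INR n + 1))))%C) :
  ex_lerch 1 2 (M + 1)%C /\
  exists f : C,
    is_contfrac (fun _ : nat => RtoC 1) b f /\
    (2 * M ^ 2 * Lerch 1 2 (M + 1))%C = (2 * M ^ 2 * Hurwitz 2 (M + 1))%C /\
    (2 * M ^ 2 * Hurwitz 2 (M + 1))%C = f.
Proof.
pose proof (lerch_series M hM) as HL.
split; [eexists; exact HL|].
eexists. split; [exact (contfrac_converges M b hM hb)|].
split; [reflexivity|].
unfold Hurwitz, Lerch. rewrite (CSeries_unique _ _ HL), hb0.
field. pos_re.
Qed.
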